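(* If $\tau=0011$ or $\tau=0112$, then $$f_\tau(x)=\frac{1-4x+5x^2-x^3}{(1-x)(1-2x)^2}$$ as formal power series in $x$, where $f_\tau(x)=\sum_{n\ge 0} b_n(\tau)x^n$ and $b_n(\tau)$ is the number of ascent sequences of length $n$ that avoid both patterns $021$ and $\tau$.
   Context: For a finite sequence $w=w_1\cdots w_n$ of integers, $\mathrm{asc}(w)$ is the number of indices $1\le i\le n-1$ with $w_i<w_{i+1}$. An ascent sequence of length $n\ge 1$ is a sequence $a_1\cdots a_n$ of non-negative integers such that $a_1=0$ and $a_i\le \mathrm{asc}(a_1\cdots a_{i-1})+1$ for $1<i\le n$; there is exactly one (empty) ascent sequence of length $0$. A sequence $\pi=\pi_1\cdots\pi_n$ contains a pattern $\tau=\tau_1\cdots\tau_m$ if there are indices $1\le i_1<\cdots<i_m\le n$ such that for all $j,k\in\{1,\dots,m\}$: $\pi_{i_j}<\pi_{i_k}$ iff $\tau_j<\tau_k$, and $\pi_{i_j}=\pi_{i_k}$ iff $\tau_j=\tau_k$; otherwise $\pi$ avoids $\tau$. For a pattern $\tau$, $B_n(\tau)$ is the set of ascent sequences of length $n$ avoiding both $021$ and $\tau$ (with $B_0(\tau)$ consisting of the empty sequence), and $b_n(\tau)=|B_n(\tau)|$. *)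

(* Defs.v *)
From mathcomp Require Import all_boot all_order all_algebra.
Set Implicit Arguments.
Unset Strict Implicit.
Unset Printing Implicit Defensive.

Import GRing.Theory.

(* For w = w_1 ... w_n the entry w_(i+1) is nth 0 w i, and the
   prefix w_1 ... w_i is take i w. *)

Definition asc (w : seq nat) : nat :=
  \sum_(0 <= i < (size w).-1) (nth 0 w i < nth 0 w i.+1).

Definition ascent_seq (w : seq nat) : bool :=
  (nth 0 w 0 == 0) &&
  [forall i : 'I_(size w), (0 < i) ==> (nth 0 w i <= asc (take i w) + 1)].

Definition contains (w tau : seq nat) : bool :=
  [exists p : {ffun 'I_(size tau) -> 'I_(size w)},
    [forall j : 'I_(size tau), forall k : 'I_(size tau),
      [&& (j < k) ==> (p j < p k),
          (nth 0 w (p j) < nth 0 w (p k)) == (nth 0 tau j < nth 0 tau k) &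
          (nth 0 w (p j) == nth 0 w (p k)) == (nth 0 tau j == nth 0 tau k)]]].

Definition avoids (w tau : seq nat) : bool := ~~ contains w tau.

Lemma asc_le (w : seq nat) : asc w <= (size w).-1.
Proof.
rewrite /asc -[X in _ <= X]muln1 -[X in _ <= X * _]subn0 -sum_nat_const_nat.
by apply: leq_sum => i _; case: (_ < _).
Qed.

(* An ascent sequence of length n has all its entries < n, so that nothing is
   lost by letting the entries range over 'I_n in B below. *)
Lemma ascent_seq_ltn (w : seq nat) :
  ascent_seq w -> all (fun a => a < size w) w.
Proof.
case/andP=> /eqP w0 /forallP Hw; apply/(all_nthP 0) => i lt_i.
case: (posnP i) => [i0 | i_gt0]; first by move: lt_i; rewrite i0 w0.
have := implyP (Hw (Ordinal lt_i)) i_gt0 => /= le_i.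
have := asc_le (take i w); rewrite size_take lt_i => le_a.
apply: leq_ltn_trans (leq_trans le_i _) lt_i.
by rewrite addn1; apply: leq_ltn_trans le_a _; rewrite prednK.
Qed.

Definition B (tau : seq nat) (n : nat) : {set n.-tuple 'I_n} :=
  [set t : n.-tuple 'I_n |
    let w := map val t in
    [&& ascent_seq w, avoids w [:: 0; 2; 1] & avoids w tau]].

Definition b (tau : seq nat) (n : nat) : nat := #|B tau n|.

Local Open Scope ring_scope.

(* A formal power series is its coefficient function; equality of series is
   pointwise equality =1. *)
Definition fps (R : Type) : Type := nat -> R.

Definition fps_mul (R : pzRingType) (s t : fps R) : fps R :=
  fun n => \sum_(i < n.+1) s i * t (n - i)%N.

Definition fps_of_poly (R : nzRingType) (p : {poly R}) : fps R := fun n => p`_n.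

(* The first n coefficients of the inverse of s, obtained by solving
   s * t = 1 for one coefficient of t after the other. *)
Fixpoint fps_inv_coefs (R : unitRingType) (s : fps R) (n : nat) : seq R :=
  if n is m.+1 then
    let t := fps_inv_coefs s m in
    rcons t ((s 0%N)^-1 * ((m == 0%N)%:R - \sum_(i < m) s i.+1 * t`_(m - i.+1)))
  else [::].

(* Only meaningful when s 0 is a unit; see fps_mulV. *)
Definition fps_inv (R : unitRingType) (s : fps R) : fps R :=
  fun n => (fps_inv_coefs s n.+1)`_n.

Definition fps_div (R : unitRingType) (s t : fps R) : fps R :=
  fps_mul s (fps_inv t).

Lemma size_fps_inv_coefs (R : unitRingType) (s : fps R) n :
  size (fps_inv_coefs s n) = n.
Proof. by elim: n => //= n IHn; rewrite size_rcons IHn. Qed.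

Lemma nth_fps_inv_coefs (R : unitRingType) (s : fps R) n i :
  (i < n)%N -> (fps_inv_coefs s n)`_i = fps_inv s i.
Proof.
elim: n => // n IHn; rewrite ltnS leq_eqVlt => /predU1P[-> // | lt_i].
by rewrite /= nth_rcons size_fps_inv_coefs lt_i IHn.
Qed.

Lemma fps_mulV (R : unitRingType) (s : fps R) :
  s 0%N \is a GRing.unit ->
  fps_mul s (fps_inv s) =1 fps_of_poly (1 : {poly R}).
Proof.
move=> Us n; rewrite /fps_mul /fps_of_poly coef1 big_ord_recl subn0.
rewrite {1}/fps_inv /= nth_rcons size_fps_inv_coefs ltnn eqxx mulVKr //.
rewrite -[RHS](subrK (\sum_(i < n) s i.+1 * (fps_inv_coefs s n)`_(n - i.+1))).
congr (_ + _); apply: eq_bigr => i _.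
by rewrite nth_fps_inv_coefs // subnSK // leq_subr.
Qed.

Definition f (tau : seq nat) : fps rat := fun n => (b tau n)%:R.

(* Main.v *)
(** Since an ascent sequence starts with 0, avoiding 021 means that the nonzero
    entries are weakly increasing.  So a prefix with maximum m can only be
    extended by 0, by m (if m > 0), or by some a with m < a <= asc + 1, and which
    of these create a copy of tau depends only on which kinds of entries are
    already repeated.  The number of extensions of a prefix by j letters is thus
    a function of j, of the slack asc - m and of a few booleans, and its
    recurrence solves to b_(n+1) = n 2^(n-1) + 1.  On the other side,
    1 / ((1 - x) (1 - 2x)^2) has coefficients n 2^(n+1) + 1. *)

Require Import Defs.
From mathcomp Require Import all_boot all_order all_algebra.
From mathcomp Require Import ring lra zify.
Import GRing.Theory.
Set Implicit Arguments.
Unset Strict Implicit.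
Unset Printing Implicit Defensive.

(** * Pattern containment through subsequences *)

(** A copy of the pattern is kept as a list of letters instead of an embedding of indices, which
    suits induction on appended letters. *)
Definition order_iso (s tau : seq nat) : Prop :=
  size s = size tau /\
  forall j k, j < size tau -> k < size tau ->
    ((nth 0 s j < nth 0 s k) = (nth 0 tau j < nth 0 tau k)) /\
    ((nth 0 s j == nth 0 s k) = (nth 0 tau j == nth 0 tau k)).

Lemma subseq_iota (s : seq nat) n :
  sorted ltn s -> all (gtn n) s -> subseq s (iota 0 n).
Proof.
move=> ss /allP sn; suff -> : s = filter (mem s) (iota 0 n).
  exact: filter_subseq.
apply: (irr_sorted_eq ltn_trans ltnn) => // [|i].
  exact: (sorted_filter ltn_trans _ (iota_ltn_sorted _ _)).
rewrite mem_filter mem_iota /= add0n.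
by case: (boolP (i \in s)) => //= /sn.
Qed.

Lemma containsP (w tau : seq nat) :
  reflect (exists2 s, subseq s w & order_iso s tau) (contains w tau).
Proof.
apply: (iffP existsP) => [[p Hp]|[s /subseqP [m szm ->] [szs Hs]]].
- have {}Hp j k := forallP (forallP Hp j) k.
  have [e eE] : exists e : seq 'I_(size tau), map val e = iota 0 (size tau).
    by exists (enum 'I_(size tau)); apply: val_enum_ord.
  have sze : size e = size tau by rewrite -(size_map val) eE size_iota.
  pose h j := val (p j).
  (* The positions chosen by [p] increase, so they form a subsequence of all positions of [w]. *)
  exists (map (nth 0 w) (map h e)).
    rewrite -[X in subseq _ X](mkseq_nth 0 w); apply: map_subseq.
    apply: subseq_iota; last by apply/allP => _ /mapP [j _ ->]; apply: ltn_ord.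
    have : sorted ltn (map val e) by rewrite eE iota_ltn_sorted.
    rewrite !sorted_map; apply: sub_sorted => j k /= jk.
    by case/and3P: (Hp j k) => /implyP /(_ jk).
  split=> [|j k jlt klt]; first by rewrite !size_map.
  have nthe i (ilt : i < size tau) :
      nth 0 (map (nth 0 w) (map h e)) i = nth 0 w (p (Ordinal ilt)).
    rewrite (nth_map 0) ?size_map ?sze // (nth_map (Ordinal ilt)) ?sze //.
    congr (nth 0 w (p _)); apply: val_inj.
    by rewrite -(nth_map _ 0) ?sze // eE nth_iota.
  rewrite !nthe.
  by case/and3P: (Hp (Ordinal jlt) (Ordinal klt)) => _ /eqP -> /eqP ->.
(* Masking the positions instead of the letters recovers the embedding of indices. *)
pose idx := mask m (iota 0 (size w)).
have sE : mask m w = map (nth 0 w) idx.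
  by rewrite map_mask -/(mkseq _ _) mkseq_nth.
have szis : size idx = size tau by rewrite -szs sE size_map.
have is_lt j : j < size tau -> nth 0 idx j < size w.
  rewrite -szis => /(mem_nth 0) /mem_mask; by rewrite mem_iota.
exists [ffun j : 'I_(size tau) => Ordinal (is_lt _ (ltn_ord j))].
apply/forallP => j; apply/forallP => k; rewrite !ffunE /=.
have [] := Hs j k (ltn_ord j) (ltn_ord k).
rewrite sE !(nth_map 0) ?szis // => -> ->; rewrite !eqxx !andbT.
apply/implyP => jk; apply: (sorted_ltn_nth ltn_trans) => //.
- exact: (sorted_mask ltn_trans _ (iota_ltn_sorted _ _)).
- by rewrite inE szis.
- by rewrite inE szis.
Qed.

(** Reversal turns the last letters into heads, where [subseq] computes. For x = a that computation
    keeps only the second disjunct, which the first one implies. *)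
Lemma subseq_rcons2 (s w : seq nat) x a :
  subseq (rcons s x) (rcons w a) =
  subseq (rcons s x) w || ((x == a) && subseq s w).
Proof.
rewrite -(subseq_rev (rcons s x) (rcons w a)) !rev_rcons /=.
case: eqP => _; rewrite /= ?orbF -?rev_rcons subseq_rev //.
case: (boolP (subseq (rcons s x) w)) => //= H.
by rewrite (subseq_trans (subseq_rcons s x) H).
Qed.

Lemma contains021P w :
  reflect (exists x y z, [/\ x < y, y < z & subseq [:: x; z; y] w])
    (contains w [:: 0; 2; 1]).
Proof.
apply: (iffP (containsP _ _)) => [[[|x [|z [|y [|? ?]]]] sw [] //= _ H]|].
  exists x, y, z; split=> //.
    by have [] := H 0 2 isT isT.
  by have [] := H 2 1 isT isT.
case=> x [y [z [xy yz sw]]]; exists [:: x; z; y] => //; split=> //.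
by move=> [|[|[|j]]] [|[|[|k]]] //= _ _; split; lia.
Qed.

Lemma contains0011P w :
  reflect (exists x y, x < y /\ subseq [:: x; x; y; y] w)
    (contains w [:: 0; 0; 1; 1]).
Proof.
apply: (iffP (containsP _ _)) => [[[|x [|x' [|y [|y' [|? ?]]]]] sw [] //= _ H]|].
  have [_ /= /eqP ex] := H 0 1 isT isT; have [_ /= /eqP ey] := H 2 3 isT isT.
  exists x, y; split; first by have [] := H 0 2 isT isT.
  by move: sw; rewrite -ex -ey.
case=> x [y [xy sw]]; exists [:: x; x; y; y] => //; split=> //.
by move=> [|[|[|[|j]]]] [|[|[|[|k]]]] //= _ _; split; lia.
Qed.

Lemma contains0112P w :
  reflect (exists x y z, [/\ x < y, y < z & subseq [:: x; y; y; z] w])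
    (contains w [:: 0; 1; 1; 2]).
Proof.
apply: (iffP (containsP _ _)) => [[[|x [|y [|y' [|z [|? ?]]]]] sw [] //= _ H]|].
  have [_ /= /eqP ey] := H 1 2 isT isT.
  exists x, y, z; split; first by have [] := H 0 1 isT isT.
    by have [] := H 1 3 isT isT.
  by move: sw; rewrite -ey.
case=> x [y [z [xy yz sw]]]; exists [:: x; y; y; z] => //; split=> //.
by move=> [|[|[|[|j]]]] [|[|[|[|k]]]] //= _ _; split; lia.
Qed.

(** A new copy x z y has 0 <= x < y < z <= m; conversely, if 0 < a < m, the leading 0, an occurrence
    of [m] and [a] form a copy. *)
Lemma contains021_rcons w a m :
  m \in 0 :: w -> all (geq m) (0 :: w) ->
  contains (rcons (0 :: w) a) [:: 0; 2; 1] =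
  contains (0 :: w) [:: 0; 2; 1] || (0 < a < m).
Proof.
move=> mw /allP wm; apply/contains021P/orP.
  case=> x [y [z [xy yz]]]; rewrite -[[:: x; z; y]]/(rcons [:: x; z] y).
  rewrite subseq_rcons2 => /orP [sw|/andP [/eqP ya sw]].
    by left; apply/contains021P; exists x, y, z.
  right; rewrite -ya (leq_ltn_trans _ xy) //=; apply: leq_trans yz _.
  have : z \in 0 :: w by apply: (mem_subseq sw); rewrite !inE eqxx orbT.
  exact: wm.
case=> [/contains021P [x [y [z [xy yz sw]]]]|/andP [a0 am]].
  by exists x, y, z; split=> //; apply: subseq_trans sw (subseq_rcons _ _).
exists 0, a, m; split=> //; rewrite -[[:: 0; m; a]]/(rcons [:: 0; m] a).
rewrite subseq_rcons2 eqxx /= sub1seq.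
by move: mw; rewrite inE => /predU1P [m0|->]; [rewrite m0 in am|rewrite orbT].
Qed.

(** * Repeated letters and new copies of 0011 and 0112 *)

Definition repeated (p : pred nat) (w : seq nat) : bool :=
  has (fun x => p x && subseq [:: x; x] w) w.

Definition repeated_before (p : pred nat) (y : nat) (w : seq nat) : bool :=
  has (fun x => p x && subseq [:: x; x; y] w) w.

Lemma repeatedP (p : pred nat) w :
  reflect (exists2 x, p x & subseq [:: x; x] w) (repeated p w).
Proof.
apply: (iffP hasP) => [[x _ /andP [px sw]]|[x px sw]]; exists x; rewrite ?px //.
by apply: (mem_subseq sw); rewrite mem_head.
Qed.

Lemma repeated_beforeP (p : pred nat) y w :
  reflect (exists2 x, p x & subseq [:: x; x; y] w) (repeated_before p y w).
Proof.
apply: (iffP hasP) => [[x _ /andP [px sw]]|[x px sw]]; exists x; rewrite ?px //.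
by apply: (mem_subseq sw); rewrite mem_head.
Qed.

Lemma eq_in_repeated (p q : pred nat) w :
  {in w, p =1 q} -> repeated p w = repeated q w.
Proof. by move=> pq; apply: eq_in_has => x /pq ->. Qed.

Lemma repeated_rcons (p : pred nat) w a :
  repeated p (rcons w a) = repeated p w || (p a && (a \in w)).
Proof.
apply/repeatedP/orP => [[x px]|].
  rewrite -[[:: x; x]]/(rcons [:: x] x) subseq_rcons2.
  case/orP=> [sw|/andP [/eqP <-]]; first by left; apply/repeatedP; exists x.
  by rewrite sub1seq px => ->; right.
case=> [/repeatedP [x px sw]|/andP [pa aw]].
  by exists x => //; apply: subseq_trans sw (subseq_rcons _ _).
exists a => //; rewrite -[[:: a; a]]/(rcons [:: a] a) subseq_rcons2 eqxx.
by rewrite sub1seq aw orbT.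
Qed.

Lemma repeated_before_rcons (p : pred nat) y w a :
  repeated_before p y (rcons w a) =
  repeated_before p y w || ((y == a) && repeated p w).
Proof.
apply/repeated_beforeP/orP => [[x px]|].
  rewrite -[[:: x; x; y]]/(rcons [:: x; x] y) subseq_rcons2.
  case/orP=> [sw|/andP [-> sw]]; first by left; apply/repeated_beforeP; exists x.
  by right; apply/repeatedP; exists x.
case=> [/repeated_beforeP [x px sw]|/andP [/eqP -> /repeatedP [x px sw]]].
  by exists x => //; apply: subseq_trans sw (subseq_rcons _ _).
exists x => //; rewrite -[[:: x; x; a]]/(rcons [:: x; x] a) subseq_rcons2 eqxx.
by rewrite sw orbT.
Qed.

Lemma repeated_before_repeated p y w : repeated_before p y w -> repeated p w.
Proof.
case/repeated_beforeP=> x px sw; apply/repeatedP; exists x => //.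
exact: subseq_trans (subseq_rcons [:: x; x] y) sw.
Qed.

Lemma repeated_before_mem p y w : repeated_before p y w -> y \in w.
Proof.
by case/repeated_beforeP=> x _ /mem_subseq; apply; rewrite !inE eqxx !orbT.
Qed.

(** A new copy must end in the appended [a], so its first three letters are x x a with x < a. *)
Lemma contains0011_rcons w a :
  contains (rcons w a) [:: 0; 0; 1; 1] =
  contains w [:: 0; 0; 1; 1] || repeated_before (gtn a) a w.
Proof.
apply/contains0011P/orP.
  case=> x [y [xy]]; rewrite -[[:: x; x; y; y]]/(rcons [:: x; x; y] y).
  rewrite subseq_rcons2 => /orP [sw|/andP [/eqP ya sw]].
    by left; apply/contains0011P; exists x, y.
  by right; apply/repeated_beforeP; exists x; rewrite -ya.
case=> [/contains0011P [x [y [xy sw]]]|/repeated_beforeP [x xa sw]].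
  by exists x, y; split=> //; apply: subseq_trans sw (subseq_rcons _ _).
exists x, a; split=> //; rewrite -[[:: x; x; a; a]]/(rcons [:: x; x; a] a).
by rewrite subseq_rcons2 eqxx sw orbT.
Qed.

(** The leading 0 can serve as the smallest letter of any new copy, so only the repeated middle
    letter matters. *)
Lemma contains0112_rcons w a :
  contains (rcons (0 :: w) a) [:: 0; 1; 1; 2] =
  contains (0 :: w) [:: 0; 1; 1; 2] || repeated (fun y => 0 < y < a) w.
Proof.
apply/contains0112P/orP.
  case=> x [y [z [xy yz]]]; rewrite -[[:: x; y; y; z]]/(rcons [:: x; y; y] z).
  rewrite subseq_rcons2 => /orP [sw|/andP [/eqP za sw]].
    by left; apply/contains0112P; exists x, y, z.
  (* Whether or not [x] is matched with the leading 0, both copies of [y] lie in [w]. *)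
  have {}sw : subseq [:: y; y] w.
    by move: sw => /=; case: ifP => // _; apply: subseq_trans (subseq_cons _ _).
  by right; apply/repeatedP; exists y; rewrite // -za yz (leq_ltn_trans _ xy).
case=> [/contains0112P [x [y [z [xy yz sw]]]]|/repeatedP [y /andP [y0 ya] sw]].
  by exists x, y, z; split=> //; apply: subseq_trans sw (subseq_rcons _ _).
exists 0, y, a; split=> //; rewrite -[[:: 0; y; y; a]]/(rcons [:: 0; y; y] a).
by rewrite subseq_rcons2 eqxx /= sw orbT.
Qed.

(** * Appending a letter to an ascent sequence *)

Lemma asc_rcons x w a :
  asc (rcons (x :: w) a) = asc (x :: w) + (last x w < a).
Proof.
rewrite /asc size_rcons /= big_nat_recr //= -!rcons_cons (last_nth 0).
rewrite !nth_rcons /= ltnSn ltnn eqxx; congr (_ + _).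
apply: eq_big_nat => i /andP [_ iw].
by rewrite -rcons_cons !nth_rcons iw (ltnW iw : i < size (x :: w)).
Qed.

(** The conditions at earlier positions see only prefixes of [x :: w], so the last position alone
    adds a new one. *)
Lemma ascent_seq_rcons x w a :
  ascent_seq (rcons (x :: w) a) =
  ascent_seq (x :: w) && (a <= asc (x :: w) + 1).
Proof.
rewrite /ascent_seq /= -andbA; congr (_ && _).
apply/forallP/andP => [H|[/forallP H Ha] [i /= ilt]].
- split.
    apply/forallP => -[i /= ilt]; apply/implyP => i0.
    have ilt' : i < (size (rcons w a)).+1 by rewrite size_rcons ltnS ltnW.
    have := implyP (H (Ordinal ilt')) i0 => /=.
    by rewrite -rcons_cons nth_rcons ilt -cats1 takel_cat // ltnW.
  have ilt' : (size w).+1 < (size (rcons w a)).+1 by rewrite size_rcons.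
  have := implyP (H (Ordinal ilt')) isT => /=.
  by rewrite nth_rcons ltnn eqxx -cats1 take_size_cat.
apply/implyP => i0; move: ilt; rewrite size_rcons ltnS leq_eqVlt => /predU1P.
case=> [->|ilt].
  by rewrite -rcons_cons nth_rcons ltnn eqxx -cats1 take_size_cat.
have := implyP (H (Ordinal ilt)) i0 => /=.
by rewrite -rcons_cons nth_rcons ilt -cats1 takel_cat // ltnW.
Qed.

Definition good (tau w : seq nat) : bool :=
  [&& ascent_seq w, avoids w [:: 0; 2; 1] & avoids w tau].

Lemma contains_rcons w tau a : contains w tau -> contains (rcons w a) tau.
Proof.
case/containsP=> s sw Hs; apply/containsP; exists s => //.
exact: subseq_trans sw (subseq_rcons _ _).
Qed.

(** Goodness passes to prefixes, so growing words letter by letter reaches every good word, with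
    finitely many candidates at each step. *)
Lemma good_rconsW tau x w a :
  good tau (rcons (x :: w) a) -> good tau (x :: w) /\ a < asc (x :: w) + 2.
Proof.
rewrite /good ascent_seq_rcons => /and3P [/andP [-> le_a] n1 n2].
split; last by rewrite addn2 ltnS -addn1.
rewrite andTb; apply/andP.
by split; [apply: contra n1|apply: contra n2]; apply: contains_rcons.
Qed.

Lemma good_catW tau x w v : good tau ((x :: w) ++ v) -> good tau (x :: w).
Proof.
elim/last_ind: v => [|v a IH]; first by rewrite cats0.
by rewrite -rcons_cat => /good_rconsW [/IH].
Qed.

(** * Extending a prefix letter by letter *)

(** Only the appended parts are listed. After a non-empty [w] the ascent condition allows letters up
    to [asc w + 1], hence the length of the [iota]. *)
Fixpoint extensions (tau : seq nat) (j : nat) (w : seq nat) : seq (seq nat) :=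
  if j is j'.+1 then
    [seq a :: v | a <- [seq a <- iota 0 (asc w + 2) | good tau (rcons w a)],
                  v <- extensions tau j' (rcons w a)]
  else [:: [::]].

Lemma mem_extensions tau j x w v :
  good tau (x :: w) ->
  (v \in extensions tau j (x :: w)) = (size v == j) && good tau ((x :: w) ++ v).
Proof.
elim: j w v => [|j IH] w v gw /=.
  by rewrite inE -size_eq0; case: v => [|? ?]; rewrite /= ?cats0 ?gw.
apply/allpairsPdep/andP => [[a [u []]]|[]].
  rewrite mem_filter => /andP [ga _]; rewrite IH // => /andP [/eqP <- gu] ->.
  by split=> //=; rewrite -cat_rcons.
case: v => [|a u] //=; rewrite eqSS -cat_rcons => su gu; exists a, u.
have ga : good tau (rcons (x :: w) a) := good_catW gu.
split=> //; last by rewrite -rcons_cons IH // su.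
by rewrite mem_filter ga mem_iota; case: (good_rconsW ga).
Qed.

Lemma uniq_extensions tau j w : uniq (extensions tau j w).
Proof.
elim: j w => [|j IH] w //=; apply: allpairs_uniq_dep => [|a _|].
- exact: filter_uniq (iota_uniq _ _).
- exact: IH.
- by move=> [a u] [a' u'] _ _ /= [-> ->].
Qed.

(** The order of the candidate letters does not affect the count, so they may be listed by kind: 0,
    the maximum, larger letters. *)
Lemma size_extensionsS tau j x w s :
  uniq s -> (forall a, (a \in s) = good tau (rcons (x :: w) a)) ->
  size (extensions tau j.+1 (x :: w)) =
  \sum_(a <- s) size (extensions tau j (rcons (x :: w) a)).
Proof.
move=> us Hs; rewrite [LHS]size_allpairs_dep sumnE big_map.
apply: perm_big; apply: uniq_perm => // [|a].
  exact: filter_uniq (iota_uniq _ _).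
rewrite mem_filter Hs mem_iota andb_idr //.
by case/good_rconsW.
Qed.

Lemma b_extensions tau n :
  good tau [:: 0] -> b tau n.+1 = size (extensions tau n [:: 0]).
Proof.
move=> g0; rewrite /b cardE.
pose vals (t : n.+1.-tuple 'I_n.+1) := map val t.
have vals_inj : injective vals.
  by move=> t u /(inj_map val_inj) /val_inj.
rewrite -(size_map vals) -[RHS](size_map (cons 0)); apply/perm_size/uniq_perm.
- by rewrite map_inj_uniq ?enum_uniq.
- by rewrite map_inj_uniq ?uniq_extensions // => ? ? [].
move=> w; apply/mapP/mapP => [[t]|[v]].
  rewrite mem_enum inE -[map val t]/(vals t) => gt ->.
  have := size_tuple t; rewrite -(size_map val) -[map val t]/(vals t).
  case: (vals t) gt => [|a v] // gt [sv].
  case/and3P: (gt) => /andP [/= /eqP a0 _] _ _; rewrite a0 in gt *.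
  by exists v; rewrite // mem_extensions // sv eqxx.
rewrite mem_extensions // => /andP [/eqP sv gv] ->.
have sv1 : size (0 :: v) == n.+1 by rewrite /= sv.
(* Entries of an ascent sequence lie below its length, so [inord] lifts them to ordinals
   unchanged. *)
have /allP lt_v : all (fun a => a < n.+1) (0 :: v).
  by rewrite -{1}(eqP sv1); apply: ascent_seq_ltn; case/and3P: gv.
pose u := map (@inord n) (0 :: v).
have su : size u == n.+1 by rewrite size_map.
have uE : vals (Tuple su) = 0 :: v.
  change (map val u = 0 :: v); rewrite -map_comp -[RHS]map_id.
  by apply/eq_in_map => a /lt_v /inordK.
by exists (Tuple su) => //; rewrite mem_enum inE -[map val _]/(vals _) uE.
Qed.

(* The prefix is 0 :: w; m is its maximum and s its slack asc - m.  For m > 0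
   the flag z tells whether appending m creates an ascent; for m = 0 it is
   irrelevant, and the use of maxn m 1 makes it true. *)
Record prefix_stat (tau w : seq nat) (m s : nat) (z : bool) : Prop :=
  PrefixStat {
    prefix_max_mem : m \in 0 :: w;
    prefix_max_ub : all (geq m) (0 :: w);
    prefix_good : good tau (0 :: w);
    prefix_asc : asc (0 :: w) = m + s;
    prefix_low : (last 0 w < maxn m 1) = z }.

Lemma good_rcons tau w m s z a :
  prefix_stat tau w m s z ->
  good tau (rcons (0 :: w) a) =
  [&& (a == 0) || (m <= a), a <= (m + s).+1 & avoids (rcons (0 :: w) a) tau].
Proof.
case=> mw wm /and3P [ga g0 _] cE _.
rewrite /good ascent_seq_rcons ga cE addn1 /avoids (contains021_rcons _ mw wm).
by rewrite (negbTE g0) /= negb_and -eqn0Ngt -leqNgt andbCA.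
Qed.

Lemma prefix_stat0 tau w m s z :
  prefix_stat tau w m s z -> good tau (rcons (0 :: w) 0) ->
  prefix_stat tau (rcons w 0) m s true.
Proof.
case=> mw wm _ cE _ g0; split=> //; rewrite -?rcons_cons.
- by rewrite mem_rcons inE mw orbT.
- by rewrite all_rcons wm andbT.
- by rewrite asc_rcons cE ltn0 addn0.
- by rewrite last_rcons leq_max orbT.
Qed.

(** The maximum stays and an ascent is added exactly when [z] holds; a further [m] right after this
    one would add none. *)
Lemma prefix_stat_max tau w m s z :
  prefix_stat tau w m s z -> 0 < m -> good tau (rcons (0 :: w) m) ->
  prefix_stat tau (rcons w m) m (s + z) false.
Proof.
case=> mw wm _ cE zE m0 gm; split=> //; rewrite -?rcons_cons.
- by rewrite mem_rcons mem_head.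
- by rewrite all_rcons wm /= leqnn.
- by rewrite asc_rcons cE -zE (maxn_idPl m0) addnA.
- by rewrite last_rcons (maxn_idPl m0) ltnn.
Qed.

(** A new maximum always makes an ascent: [asc] grows by 1 and the maximum by i + 1, so the slack
    drops by i. *)
Lemma prefix_stat_up tau w m s z i :
  prefix_stat tau w m s z -> i <= s -> good tau (rcons (0 :: w) (m.+1 + i)) ->
  prefix_stat tau (rcons w (m.+1 + i)) (m.+1 + i) (s - i) false.
Proof.
case=> mw wm _ cE zE le_is gm; split=> //; rewrite -?rcons_cons.
- by rewrite mem_rcons mem_head.
- rewrite all_rcons /= leqnn /=; case/andP: wm => _.
  by apply: sub_all => x /= /leq_trans; apply; rewrite ltnW // leq_addr.
- have le_l : last 0 w <= m by apply: (allP wm); apply: mem_last.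
  by rewrite asc_rcons cE addSn ltnS (leq_trans le_l (leq_addr _ _)); lia.
- by rewrite last_rcons (maxn_idPl _) ?ltnn.
Qed.

(* d forbids the letter m, f forbids the letters above m; for m = 0 the letter m
   is the letter 0, which d then keeps from being counted twice. *)
Lemma size_extensions_stat tau w m s z (d f : bool) j :
  prefix_stat tau w m s z ->
  good tau (rcons (0 :: w) 0) ->
  (0 < m -> good tau (rcons (0 :: w) m) = ~~ d) -> (m = 0 -> d) ->
  (forall i, i <= s -> good tau (rcons (0 :: w) (m.+1 + i)) = ~~ f) ->
  size (extensions tau j.+1 (0 :: w)) =
  size (extensions tau j (0 :: rcons w 0)) +
  (if d then 0 else size (extensions tau j (0 :: rcons w m))) +
  (if f then 0 else \sum_(0 <= i < s.+1)
                      size (extensions tau j (0 :: rcons w (m.+1 + i)))).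
Proof.
move=> st g0 gm d0 gup.
have d_m : ~~ d -> 0 < m by case: (posnP m) => // m0; rewrite d0.
pose lm := if d then [::] else [:: m].
pose lu := if f then [::] else iota m.+1 s.+1.
have mem_lm a : (a \in lm) = ~~ d && (a == m).
  by rewrite /lm; case: (d); rewrite ?mem_seq1.
have mem_lu a : (a \in lu) = [&& ~~ f, m < a & a <= (m + s).+1].
  by rewrite /lu; case: (f); rewrite // mem_iota addSn addnS ltnS.
rewrite (@size_extensionsS _ _ _ _ (0 :: lm ++ lu)).
- rewrite big_cons big_cat -addnA; congr (_ + (_ + _)).
    by rewrite /lm; case: (d); rewrite ?big_nil ?big_seq1.
  rewrite /lu; case: (f); rewrite ?big_nil //.
  by rewrite -[X in iota X]addn0 iotaDl big_map /index_iota subn0.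
- rewrite cons_uniq mem_cat cat_uniq negb_or mem_lm mem_lu ltn0 /= andbF andbT.
  have -> : uniq lm by rewrite /lm; case: (d).
  have -> : uniq lu by rewrite /lu; case: (f) => //; apply: iota_uniq.
  rewrite andbT /=; apply/andP; split.
    by apply/negP => /andP [/d_m /prednK <-].
  apply/hasPn => a; rewrite mem_lu mem_lm; case/and3P=> _ /gtn_eqF -> _.
  by rewrite andbF.
move=> a; rewrite inE mem_cat mem_lm mem_lu.
have [->|a0] := posnP a; first by rewrite g0.
have [am|ma|am] := ltngtP a m.
- by rewrite (good_rcons _ st) [m <= a]leqNgt am (gtn_eqF a0) !andbF.
- rewrite andbF /=; case: (leqP a (m + s).+1) => [le_a|lt_a].
    by rewrite andbT -(subnKC ma) gup //; lia.
  by rewrite andbF (good_rcons _ st) [a <= _]leqNgt lt_a /= andbF.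
- by rewrite am gm -?am //= andbT andbF orbF.
Qed.

(** * Counting extensions *)

(* With m the maximum of the prefix, and all flags but f being true when m = 0:
   d: some x < m occurs twice before an occurrence of m, which forbids m;
   e: some x < m is repeated, so that appending m turns d on;
   f: some letter is repeated, so that a new maximum turns d and e on. *)
Fixpoint count0011 (j s : nat) (z d e f : bool) : nat :=
  if j is j'.+1 then
    count0011 j' s true d true true +
    (if d then 0 else count0011 j' (s + z) false e e true) +
    \sum_(0 <= i < s.+1) count0011 j' (s - i) false f f f
  else 1.

(* e: m = 0 or some y with 0 < y < m is repeated, which forbids m;
   f: some y > 0 is repeated, which forbids a new maximum. *)
Fixpoint count0112 (j s : nat) (z e f : bool) : nat :=
  if j is j'.+1 then
    count0112 j' s true e f +
    (if e then 0 else count0112 j' (s + z) false e true) +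
    (if f then 0 else \sum_(0 <= i < s.+1) count0112 j' (s - i) false f f)
  else 1.

Lemma prefix_stat_nil tau : good tau [:: 0] -> prefix_stat tau [::] 0 0 true.
Proof. by move=> g0; split; rewrite // /asc /= big_geq. Qed.

(** Induction on [j], following the flags: a 0 repeats the leading 0 and sets [e] and [f]; an [m]
    turns [d] into [e] and sets [f]; below a new maximum lie all earlier letters, so [d] and [e]
    both become [f]. *)
Lemma size_extensions0011 j w m s z d e f :
  prefix_stat [:: 0; 0; 1; 1] w m s z ->
  (m == 0) || repeated_before (gtn m) m (0 :: w) = d ->
  (m == 0) || repeated (gtn m) (0 :: w) = e ->
  repeated predT (0 :: w) = f ->
  size (extensions [:: 0; 0; 1; 1] j (0 :: w)) = count0011 j s z d e f.
Proof.
elim: j w m s z d e f => [//|j IH] w m s z d e f st dE eE fE.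
have [mw wm gw _ _] := st.
have goodE a : good [:: 0; 0; 1; 1] (rcons (0 :: w) a) =
    [&& (a == 0) || (m <= a), a <= (m + s).+1
      & ~~ repeated_before (gtn a) a (0 :: w)].
  rewrite (good_rcons _ st) /avoids contains0011_rcons negb_or.
  by case/and3P: gw => _ _; rewrite /avoids => ->.
have g0 : good [:: 0; 0; 1; 1] (rcons (0 :: w) 0).
  by rewrite goodE /=; apply/negP => /repeated_beforeP [].
have gm : 0 < m -> good [:: 0; 0; 1; 1] (rcons (0 :: w) m) = ~~ d.
  by rewrite goodE -dE leqnn orbT leqW ?leq_addr // => /gtn_eqF ->.
have notin i : (m.+1 + i \in 0 :: w) = false.
  by apply/negP => /(allP wm) /=; rewrite addSn ltnNge leq_addr.
have gup i : i <= s -> good [:: 0; 0; 1; 1] (rcons (0 :: w) (m.+1 + i)).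
  move=> le_is; rewrite goodE addSn /= ltnS leq_add2l le_is -addSn.
  rewrite leqW ?leq_addr //=.
  by apply/negP => /repeated_before_mem; rewrite notin.
rewrite (@size_extensions_stat _ _ _ _ _ d false _ st) //=; last first.
  by move=> m0; rewrite -dE m0.
congr (_ + _ + _).
- apply: (IH _ m); rewrite -?rcons_cons.
  + exact: prefix_stat0 st g0.
  + rewrite repeated_before_rcons -dE; case: (posnP m) => //= _.
    by rewrite orbF.
  + by rewrite repeated_rcons mem_head andbT /=; case: (posnP m); rewrite ?orbT.
  + by rewrite repeated_rcons mem_head orbT.
- case: ifP => // /negbT d_; have m0 : 0 < m.
    by case: (posnP m) d_ => // m0; rewrite -dE m0.
  apply: (IH _ m); rewrite -?rcons_cons.
  + by apply: (prefix_stat_max st m0); rewrite gm.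
  (* The old [d] implies [e], so their disjunction is [e]. *)
  + rewrite repeated_before_rcons eqxx -eE (gtn_eqF m0) /=.
    by apply/orb_idl; apply: repeated_before_repeated.
  + by rewrite repeated_rcons /= ltnn orbF.
  + by rewrite repeated_rcons mw orbT.
- apply: eq_big_nat => i /andP [_]; rewrite ltnS => le_is.
  have rE : repeated (gtn (m.+1 + i)) (0 :: w) = f.
    rewrite -fE; apply: eq_in_repeated => x /(allP wm) /= xm.
    by rewrite (leq_trans _ (leq_addr _ _)).
  apply: (IH _ (m.+1 + i)); rewrite -?rcons_cons.
  + exact: prefix_stat_up st le_is (gup _ le_is).
  + rewrite repeated_before_rcons eqxx rE.
    by apply: (@orb_idl _ f) => /repeated_before_mem; rewrite notin.
  + by rewrite repeated_rcons notin rE andbF orbF.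
  + by rewrite repeated_rcons notin fE andbF orbF.
Qed.

(** Only positive letters count, so a 0 changes no flag. An [m] is a repetition and sets [f]. A new
    maximum is possible only while [f] is false and leaves both flags false. *)
Lemma size_extensions0112 j w m s z e f :
  prefix_stat [:: 0; 1; 1; 2] w m s z ->
  (m == 0) || repeated (fun y => 0 < y < m) w = e ->
  repeated (fun y => 0 < y) w = f ->
  size (extensions [:: 0; 1; 1; 2] j (0 :: w)) = count0112 j s z e f.
Proof.
elim: j w m s z e f => [//|j IH] w m s z e f st eE fE.
have [mw wm gw _ _] := st; have /andP [_ /allP wm'] := wm.
have goodE a : good [:: 0; 1; 1; 2] (rcons (0 :: w) a) =
    [&& (a == 0) || (m <= a), a <= (m + s).+1
      & ~~ repeated (fun y => 0 < y < a) w].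
  rewrite (good_rcons _ st) /avoids contains0112_rcons negb_or.
  by case/and3P: gw => _ _; rewrite /avoids => ->.
have g0 : good [:: 0; 1; 1; 2] (rcons (0 :: w) 0).
  by rewrite goodE /=; apply/negP => /repeatedP [x]; rewrite ltn0 andbF.
have gm : 0 < m -> good [:: 0; 1; 1; 2] (rcons (0 :: w) m) = ~~ e.
  by rewrite goodE -eE leqnn orbT leqW ?leq_addr // => /gtn_eqF ->.
have repE i : repeated (fun y => 0 < y < m.+1 + i) w = f.
  rewrite -fE; apply: eq_in_repeated => x /wm' /= xm.
  by rewrite addSn ltnS (leq_trans xm (leq_addr _ _)) andbT.
have notin i : (m.+1 + i \in w) = false.
  by apply/negP => /wm' /=; rewrite addSn ltnNge leq_addr.
have gup i : i <= s -> good [:: 0; 1; 1; 2] (rcons (0 :: w) (m.+1 + i)) = ~~ f.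
  move=> le_is; rewrite goodE repE addSn /= ltnS leq_add2l le_is.
  by rewrite leqW ?leq_addr.
rewrite (@size_extensions_stat _ _ _ _ _ e f _ st) //=; last first.
  by move=> m0; rewrite -eE m0.
congr (_ + _ + _).
- apply: (IH _ m).
  + exact: prefix_stat0 st g0.
  + by rewrite repeated_rcons /= orbF.
  + by rewrite repeated_rcons /= orbF.
- case: ifP => // /negbT e_; have m0 : 0 < m.
    by case: (posnP m) e_ => // m0; rewrite -eE m0.
  apply: (IH _ m).
  + by apply: (prefix_stat_max st m0); rewrite gm.
  + by rewrite repeated_rcons ltnn andbF /= orbF eE (negbTE e_).
  (* As m > 0, the earlier occurrence of [m] is not the leading 0 and so lies in [w]. *)
  + rewrite repeated_rcons m0; move: mw; rewrite inE (gtn_eqF m0) => /= ->.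
    by rewrite orbT.
- case: ifP => // /negbT f_.
  apply: eq_big_nat => i /andP [_]; rewrite ltnS => le_is.
  apply: (IH _ (m.+1 + i)).
  + by apply: (prefix_stat_up st le_is); rewrite gup.
  + by rewrite repeated_rcons notin repE andbF orbF (negbTE f_).
  + by rewrite repeated_rcons notin fE andbF orbF (negbTE f_).
Qed.

(** * Closed forms of the counts *)

(** This makes the recurrences linear in 2^j and j 2^(j-1); at j = 0 the truncated exponent is
    harmless because of the factor j. *)
Lemma mul_exp2_predS j : j.+1 * 2 ^ j = 2 * (j * 2 ^ j.-1) + 2 ^ j.
Proof. by case: j => [|j] //=; rewrite !expnS; ring. Qed.

(** Few states are reachable from the prefix 0, and they are solved in order of dependence. In [V2]
    and [S] the letter m is forbidden, with slack 0 and 1. In [V1] the last letter is 0 and m is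
    still allowed; appending it gives slack 1. In [U1] only m is repeated, and [U0] belongs to the
    prefix 01...m with m > 0. *)
Lemma count0011_init j : count0011 j 0 true true true false = j * 2 ^ j.-1 + 1.
Proof.
have sum1 F : \sum_(0 <= i < 1) F i = F 0 :> nat by rewrite big_nat1.
have V2 i z e : count0011 i 0 z true e true = 2 ^ i.
  by elim: i z e => [|i IH] z e //=; rewrite sum1 !IH expnS; lia.
have S i z e : count0011 i 1 z true e true = 2 ^ i + i * 2 ^ i.-1.
  elim: i z e => [|i IH] z e //=.
  by rewrite big_nat_recl // sum1 !IH V2 mul_exp2_predS expnS; lia.
have V1 i : count0011 i 0 true false true true = 2 ^ i + i * 2 ^ i.-1.
  by elim: i => [|i IH] //=; rewrite sum1 !IH V2 S mul_exp2_predS expnS; lia.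
have U1 i : count0011 i 0 false false false true = 2 ^ i + i * 2 ^ i.-1.
  by elim: i => [|i IH] //=; rewrite sum1 !IH V2 V1 mul_exp2_predS expnS; lia.
have U0 i : count0011 i 0 false false false false = i * 2 ^ i + 1.
  elim: i => [|i IH] //=; rewrite sum1 !IH V1 U1 expnS.
  by case: i {IH} => [|i] //=; rewrite expnS; lia.
elim: j => [|j IH] //=; rewrite sum1 V2 U0; lia.
Qed.

(** In [R] the maximum is repeated, so only 0 and m can follow, whatever the slack. In [N] no
    positive letter is repeated; 0 and m + 1 keep it so, while m leads to [R]. *)
Lemma count0112_init j : count0112 j 0 true true false = j * 2 ^ j.-1 + 1.
Proof.
have sum1 F : \sum_(0 <= i < 1) F i = F 0 :> nat by rewrite big_nat1.
have R i s z : count0112 i s z false true = 2 ^ i.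
  by elim: i s z => [|i IH] s z //=; rewrite !IH expnS; lia.
have N i z : count0112 i 0 z false false = 2 ^ i + i * 2 ^ i.-1.
  by elim: i z => [|i IH] z //=; rewrite sum1 !IH R mul_exp2_predS expnS; lia.
elim: j => [|j IH] //=; rewrite sum1 N IH mul_exp2_predS; lia.
Qed.

Lemma contains_size w tau : contains w tau -> size tau <= size w.
Proof. by case/containsP=> s /size_subseq le [<-]. Qed.

Lemma good_nil tau : 0 < size tau -> good tau [::].
Proof.
move=> tau0; apply/and3P; split.
- by apply/andP; split=> //; apply/forallP => -[].
- by apply/negP => /contains_size.
- by apply/negP => /contains_size; rewrite leqNgt tau0.
Qed.

Lemma good_0 tau : 1 < size tau -> good tau [:: 0].
Proof.
move=> tau1; apply/and3P; split.
- by apply/andP; split=> //; apply/forallP => -[[|i] ?].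
- by apply/negP => /contains_size.
- by apply/negP => /contains_size; rewrite leqNgt tau1.
Qed.

Lemma b0 tau : 0 < size tau -> b tau 0 = 1.
Proof.
move=> tau0; have -> : b tau 0 = #|[set: 0.-tuple 'I_0]|.
  congr #|pred_of_set _|; apply/setP => t; rewrite !inE tuple0 /=.
  exact: good_nil.
by rewrite cardsT card_tuple.
Qed.

Lemma bS tau n :
  tau = [:: 0; 0; 1; 1] \/ tau = [:: 0; 1; 1; 2] ->
  b tau n.+1 = n * 2 ^ n.-1 + 1.
Proof.
case=> ->; rewrite b_extensions ?good_0 //.
- rewrite -count0011_init; apply: (@size_extensions0011 _ _ 0) => //.
  exact/prefix_stat_nil/good_0.
- rewrite -count0112_init; apply: (@size_extensions0112 _ _ 0) => //.
  exact/prefix_stat_nil/good_0.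
Qed.

(** * Power series *)

Local Open Scope ring_scope.

Import GRing.Theory.

(** From index 3 on all four coefficients of [p] contribute, and those of degree 4 and more
    vanish. *)
Lemma fps_mul_poly_cubic (R : nzRingType) (p : {poly R}) (t : fps R) n :
  (size p <= 4)%N ->
  fps_mul (fps_of_poly p) t n.+3 =
  p`_0 * t n.+3 + p`_1 * t n.+2 + p`_2 * t n.+1 + p`_3 * t n.
Proof.
move=> szp; rewrite /fps_mul /fps_of_poly !big_ord_recl /= big1 => [|i _].
  by rewrite addr0 !addrA !subSS !subn0.
by rewrite nth_default ?mul0r // (leq_trans szp).
Qed.

Definition numer : {poly rat} := 1 - 4 * 'X + 5 * 'X^2 - 'X^3.
Definition denom : {poly rat} := (1 - 'X) * (1 - 2 * 'X) ^+ 2.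

Lemma numerE : numer = Poly [:: 1; - 4; 5; - 1].
Proof.
rewrite /numer /= !cons_poly_def mul0r add0r !polyCN polyC1.
have -> : 4%:P = 4 :> {poly rat} by rewrite (rmorph_nat polyC 4).
have -> : 5%:P = 5 :> {poly rat} by rewrite (rmorph_nat polyC 5).
ring.
Qed.

Lemma denomE : denom = Poly [:: 1; - 5; 8; - 4].
Proof.
rewrite /denom /= !cons_poly_def mul0r add0r !polyCN polyC1.
have -> : 4%:P = 4 :> {poly rat} by rewrite (rmorph_nat polyC 4).
have -> : 5%:P = 5 :> {poly rat} by rewrite (rmorph_nat polyC 5).
have -> : 8%:P = 8 :> {poly rat} by rewrite (rmorph_nat polyC 8).
ring.
Qed.

(** The product with the inverse being 1 gives the recurrence q(n+3) = 5 q(n+2) - 8 q(n+1) + 4 q(n),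
    with characteristic roots 1, 2, 2; the first three coefficients are solved for separately. *)
Lemma fps_inv_denom n :
  fps_inv (fps_of_poly denom) n = n%:R * 2 ^+ n.+1 + 1.
Proof.
have unit0 : fps_of_poly denom 0%N \is a GRing.unit.
  by rewrite /fps_of_poly denomE coef_Poly.
have := fps_mulV unit0; move: (fps_inv _) => q mulV.
elim/ltn_ind: n => -[|[|[|n]]] IH.
- have := mulV 0%N; rewrite /fps_mul /fps_of_poly !big_ord_recl big_ord0 /=.
  rewrite denomE !coef_Poly coef1 /= => H; lra.
- have := mulV 1%N; rewrite /fps_mul /fps_of_poly !big_ord_recl big_ord0 /=.
  rewrite /bump /= !subSS subn0 (IH 0%N) // denomE !coef_Poly coef1 /= => H; lra.
- have := mulV 2%N; rewrite /fps_mul /fps_of_poly !big_ord_recl big_ord0 /=.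
  rewrite /bump /= !subSS subn0 (IH 0%N) // (IH 1%N) //.
  rewrite denomE !coef_Poly coef1 /= => H; lra.
have szQ : (size denom <= 4)%N by rewrite denomE size_Poly.
have := mulV n.+3.
rewrite (fps_mul_poly_cubic _ _ szQ) (IH n.+2) // (IH n.+1) //.
rewrite (IH n) ?ltnS 1?leqW // denomE !coef_Poly /fps_of_poly coef1 /=.
rewrite !exprS -!natr1; move: (2 ^+ n) => y H.
lra.
Qed.

(** The four-term formula starts at index 3, where k = n + 2 and the value is (n+2) 2^(n+1) + 1; the
    coefficients 0, 1 and 2 are computed directly. *)
Lemma fps_div_numer_denom n :
  fps_div (fps_of_poly numer) (fps_of_poly denom) n =
  if n is k.+1 then (k * 2 ^ k.-1 + 1)%:R else 1.
Proof.
rewrite /fps_div; case: n => [|[|[|n]]].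
- rewrite /fps_mul !big_ord_recl big_ord0 !fps_inv_denom /fps_of_poly numerE.
  by rewrite !coef_Poly.
- rewrite /fps_mul !big_ord_recl big_ord0 !fps_inv_denom /fps_of_poly numerE.
  by rewrite !coef_Poly.
- rewrite /fps_mul !big_ord_recl big_ord0 !fps_inv_denom /fps_of_poly numerE.
  by rewrite !coef_Poly.
have szP : (size numer <= 4)%N by rewrite numerE size_Poly.
rewrite (fps_mul_poly_cubic _ _ szP) !fps_inv_denom numerE !coef_Poly /=.
rewrite natrD natrM natrX !exprS -!natr1; move: (2 ^+ n) => y.
lra.
Qed.

Theorem theorem2p2 (tau : seq nat)
    (Htau : tau = [:: 0; 0; 1; 1]%N \/ tau = [:: 0; 1; 1; 2]%N) :
  f tau =1
    fps_div (fps_of_poly (1 - 4 * 'X + 5 * 'X^2 - 'X^3 : {poly rat}))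
            (fps_of_poly ((1 - 'X) * (1 - 2 * 'X) ^+ 2 : {poly rat})).
Proof.
case=> [|n]; rewrite fps_div_numer_denom /f.
  by rewrite b0 //; case: Htau => ->.
by rewrite bS.
Qed.
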